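(* Let $n\ge 1$ and let $a_1,\dots,a_n$ be integers with $a_n\neq 0$. Suppose that all roots of the algebraic equation $$x^n=a_1x^{n-1}+a_2x^{n-2}+\dots+a_n$$ are pairwise distinct and that the equation has a real root $x_1$ whose modulus is greater than the moduli of all the other roots. Then the 1-periodic recurrent fraction of order $n$ built from $a_1,\dots,a_n$ represents this root, i.e. its rational truncations $P_m/Q_m$ satisfy $$\lim_{m\to\infty}\frac{P_m}{Q_m}=x_1.$$
   Context: Parapermanent. For a triangular table $A=(a_{ij})_{1\le j\le i\le N}$ put $\{a_{ij}\}=\prod_{k=j}^{i}a_{ik}$ (factorial product) and $$\mathrm{pper}(A)=\sum_{r=1}^{N}\ \sum_{p_1+\dots+p_r=N}\ \prod_{s=1}^{r}\{a_{p_1+\dots+p_s,\;p_1+\dots+p_{s-1}+1}\},$$ the inner sum running over positive integers $p_1,\dots,p_r$ with sum $N$; the parapermanent of the empty table is $1$. 1-periodic recurrent fraction. Given $a_1,\dots,a_n$, consider the infinite triangular table with entries $c_{ii}=a_1$, $c_{ij}=a_{i-j+1}/a_{i-j}$ for $1\le i-j\le n-1$, and $c_{ij}=0$ for $i-j\ge n$. (Factorial products $\{c_{ij}\}$ are evaluated by formal cancellation, so $\{c_{ij}\}=a_{i-j+1}$ for $i-j\le n-1$ and $\{c_{ij}\}=0$ for $i-j\ge n$.) Let $P_m$ be the parapermanent of the table formed by rows $1,\dots,m$, and let $Q_m$ be the parapermanent of the table of order $m-1$ obtained from it by deleting the first row and the first column ($Q_1=1$). The 1-periodic recurrent fraction of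 order $n$ is the formal quotient of the two corresponding infinite parapermanents, $P_m/Q_m$ is its $m$-th rational truncation (defined for all sufficiently large $m$ under the hypotheses), and its value is $\lim_{m\to\infty}P_m/Q_m$. *)

(* Defs.v *)
From HB Require Import structures.
From mathcomp Require Import all_boot all_order all_algebra.
From mathcomp Require Import all_classical all_reals all_analysis.
From mathcomp Require Import complex.

Set Implicit Arguments.
Unset Strict Implicit.
Unset Printing Implicit Defensive.

Import Order.TTheory GRing.Theory Num.Theory.
Import numFieldNormedType.Exports.

Local Open Scope ring_scope.

(* A triangular table is a function of the row i and the column j, both       *)
(* counted from 1; a table of order N only uses the values 1 <= j <= i <= N.   *)

Definition fact_prod (K : comNzRingType) (A : nat -> nat -> K) (i j : nat) : K :=
  \prod_(j <= k < i.+1) A i k.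

(* The parapermanent depends on the entries only through the factorial         *)
(* products, so it is defined on the table F i j = {a_ij} of these products.   *)
(* This makes sense of the parapermanent when an entry is a quotient with a    *)
(* vanishing denominator but its factorial products are defined by formal      *)
(* cancellation.  The ordinals s : 'I_r are counted from 0, so p s is p_(s+1). *)
Definition pper_fact (K : comNzRingType) (N : nat) (F : nat -> nat -> K) : K :=
  if N == 0%N then 1 else
  \sum_(1 <= r < N.+1)
    \sum_(p : {ffun 'I_r -> 'I_N.+1} |
            [forall s, (0 < p s)%N] && (\sum_s p s == N)%N)
      \prod_(s < r)
        F (\sum_(t < r | (t <= s)%N) p t)%N (\sum_(t < r | (t < s)%N) p t).+1.

Definition pper (K : comNzRingType) (N : nat) (A : nat -> nat -> K) : K :=
  pper_fact N (fact_prod A).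

(* Deletion of the first row and the first column.  It commutes with           *)
(* fact_prod (fact_prod_del1 below), so it applies to entries as well as to    *)
(* factorial products.                                                         *)
Definition del1 (K : Type) (A : nat -> nat -> K) (i j : nat) : K := A i.+1 j.+1.

(* Only the values a 1, ..., a n are used below. *)
Definition rfrac_entry (K : fieldType) (n : nat) (a : nat -> K) (i j : nat) : K :=
  if i == j then a 1%N
  else if (i - j < n)%N then a (i - j).+1 / a (i - j)%N else 0.

(* The factorial products of rfrac_entry after formal cancellation; by         *)
(* rfracP_pper and rfracQ_pper below, rfracP and rfracQ are the parapermanents *)
(* of the tables of entries when no denominator vanishes.                      *)
Definition rfrac_fact (K : comNzRingType) (n : nat) (a : nat -> K) (i j : nat) : K :=
  if (i - j < n)%N then a (i - j).+1 else 0.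

Definition rfracP (K : comNzRingType) (n : nat) (a : nat -> K) (m : nat) : K :=
  pper_fact m (rfrac_fact n a).

Definition rfracQ (K : comNzRingType) (n : nat) (a : nat -> K) (m : nat) : K :=
  pper_fact m.-1 (del1 (rfrac_fact n a)).

(* x^n - (a_1 x^(n-1) + ... + a_n) *)
Definition rfrac_poly (K : nzRingType) (n : nat) (a : nat -> K) : {poly K} :=
  'X^n - \sum_(1 <= k < n.+1) (a k)%:P * 'X^(n - k).

Lemma fact_prod_del1 (K : comNzRingType) (A : nat -> nat -> K) (i j : nat) :
  fact_prod (del1 A) i j = del1 (fact_prod A) i j.
Proof. by rewrite /fact_prod /del1 [RHS]big_add1. Qed.

Lemma fact_prod_rfrac_entry (K : fieldType) (n : nat) (a : nat -> K) (i j : nat) :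
  (0 < n)%N -> (forall k, (0 < k < n)%N -> a k != 0) -> (j <= i)%N ->
  fact_prod (rfrac_entry n a) i j = rfrac_fact n a i j.
Proof.
move=> n_gt0 a_neq0 le_ji; rewrite /fact_prod /rfrac_fact -(subKn le_ji).
move: (i - j)%N (leq_subr j i) => d le_di; rewrite subKn //.
elim: d le_di => [|d IHd] lt_di.
  by rewrite subn0 big_nat1 /rfrac_entry eqxx n_gt0.
have lt_sub : (i - d.+1 < i)%N by rewrite -subn_gt0 subKn.
rewrite big_ltn ?(ltnW lt_sub)//; last by rewrite ltnS ltnW.
have -> : (i - d.+1).+1 = (i - d)%N by rewrite subnSK.
rewrite (IHd (ltnW lt_di)) {1}/rfrac_entry (gtn_eqF lt_sub) subKn //.
case: ifP => [lt_dn|_]; last by rewrite mul0r.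
by rewrite (ltnW lt_dn) divfK // a_neq0.
Qed.

Lemma eq_pper_fact (K : comNzRingType) (N : nat) (F G : nat -> nat -> K) :
  (forall i j, (0 < j <= i)%N -> F i j = G i j) -> pper_fact N F = pper_fact N G.
Proof.
move=> eqFG; rewrite /pper_fact; case: ifP => // _.
apply: eq_bigr => r _; apply: eq_bigr => p /andP[/forallP p_gt0 _].
apply: eq_bigr => s _; apply: eqFG => /=.
rewrite [X in (_ < X)%N](bigD1 s) //= -[X in (X < _)%N]add0n -addSn leq_add //.
rewrite leq_eqVlt; apply/orP; left; apply/eqP; apply: eq_bigl => t.
by rewrite ltn_neqAle andbC.
Qed.

Lemma rfracP_pper (K : fieldType) (n : nat) (a : nat -> K) (m : nat) :
  (0 < n)%N -> (forall k, (0 < k < n)%N -> a k != 0) ->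
  rfracP n a m = pper m (rfrac_entry n a).
Proof.
move=> n_gt0 a_neq0; apply: eq_pper_fact => i j /andP[_ le_ji].
by rewrite fact_prod_rfrac_entry.
Qed.

Lemma rfracQ_pper (K : fieldType) (n : nat) (a : nat -> K) (m : nat) :
  (0 < n)%N -> (forall k, (0 < k < n)%N -> a k != 0) ->
  rfracQ n a m = pper m.-1 (del1 (rfrac_entry n a)).
Proof.
move=> n_gt0 a_neq0; apply: eq_pper_fact => i j /andP[_ le_ji].
by rewrite fact_prod_del1 /del1 fact_prod_rfrac_entry.
Qed.

(* Main.v *)
Require Import Defs.
From mathcomp Require Import all_boot all_order all_algebra.
From mathcomp Require Import all_classical all_reals all_analysis.
From mathcomp Require Import complex.
From mathcomp Require Import ring.

Import Order.TTheory GRing.Theory Num.Theory.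
Import numFieldNormedType.Exports.

Local Open Scope ring_scope.
Local Open Scope classical_set_scope.
Local Open Scope complex_scope.

Set Implicit Arguments.
Unset Strict Implicit.

(** Write u_m = P_m and B = a_1 X + ... + a_n X^n.  In the parapermanent P_m the
    factorial product of a block of length p is a_p when p <= n and 0 otherwise,
    whatever the position of the block, so P_m is the sum over all compositions
    of m of products of coefficients of B, that is, the coefficient of X^m in
    1 + B + B^2 + ... = 1 / (1 - B).  Hence u satisfies the linear recurrence
    u_m = a_1 u_(m-1) + ... + a_n u_(m-n) with u_0 = 1 and u_m = 0 for m < 0
    ([rfracP_rec]).  By the same translation invariance Q_m = u_(m-1), and the
    theorem says that the ratio of consecutive terms tends to the dominant root.

    Let w be the sequence u delayed by n - 1 places ([rfrac_seq]), so that w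
    starts with n - 1 zeros and a 1, and let L_m be the linear form on
    polynomials sending X^k to w_(m+k) ([poly_shift]).  The recurrence says that
    L_m kills the characteristic polynomial (X - x1) q, where q is the product
    of the X - z over the other roots z.  Therefore L_m(q) is geometric of ratio
    x1, and its initial value is 1 since q is monic of degree n - 1:
    L_m(q) = x1^m exactly ([poly_shift_cofactor]).

    After division by x1^m the left-hand side is the sequence w_m / x1^m to which
    the operators g |-> x1 (g_(m+1) - (z / x1) g_m) have been applied, one for each
    root z in q.  As |z / x1| < 1, each of them reflects convergence
    ([cvg_affine_rec]) and keeps limits nonzero; removing them one at a time
    shows that w_m / x1^m tends to some c != 0 ([cvg_cancel_factors]).  This
    gives at once that w_m is eventually nonzero and that w_(m+1) / w_m tends
    to x1. *)

(** * Parapermanents as coefficients of a geometric series *)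

(** The constant coefficient is forced to 0: the parts of a composition are
    positive, while [a 0] is arbitrary. *)
Definition rfrac_gen (K : comNzRingType) (n : nat) (a : nat -> K) : {poly K} :=
  \poly_(k < n.+1) (if k == 0%N then 0 else a k).

Lemma coef_exp_congr (K : comNzRingType) (p q : {poly K}) (N r : nat) :
  (forall k, (k <= N)%N -> p`_k = q`_k) ->
  forall k, (k <= N)%N -> (p ^+ r)`_k = (q ^+ r)`_k.
Proof.
move=> eq_pq; elim: r => [|r IHr] k le_kN; first by rewrite !expr0.
rewrite !exprS !coefM; apply: eq_bigr => i _.
rewrite eq_pq ?(leq_trans (leq_ord i))// IHr //.
exact: leq_trans (leq_subr _ _) le_kN.
Qed.

(** Expanding the r-th power chooses one monomial in each of the r factors.  The
    exponents chosen are at most N, which is what bounds the values of [f] as in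
    the definition of the parapermanent. *)
Lemma coef_exp_sum (K : comNzRingType) (p : {poly K}) (r N : nat) :
  (p ^+ r)`_N = \sum_(f : {ffun 'I_r -> 'I_N.+1} | (\sum_s f s == N)%N)
                  \prod_(s < r) p`_(f s).
Proof.
rewrite (@coef_exp_congr _ _ (\poly_(k < N.+1) p`_k) N) //; last first.
  by move=> k le_kN; rewrite coef_poly ltnS le_kN.
have -> : (\poly_(k < N.+1) p`_k) ^+ r
    = \prod_(s < r) \sum_(k < N.+1) p`_k *: 'X^k.
  by rewrite prodr_const card_ord poly_def.
rewrite bigA_distr_bigA coef_sum [RHS]big_mkcond; apply: eq_bigr => f _ /=.
rewrite scaler_prod -expr_sum coefZ coefXn eq_sym.
by case: eqP => _; rewrite ?mulr1 ?mulr0.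
Qed.

Lemma coef_rfrac_gen (K : comNzRingType) (n : nat) (a : nat -> K) (k : nat) :
  (rfrac_gen n a)`_k = if (0 < k <= n)%N then a k else 0.
Proof. by rewrite coef_poly ltnS; case: k => [|k] //=; rewrite if_same. Qed.

(** The factorial product of a block depends only on its length p, not on the
    number i of rows before it. *)
Lemma rfrac_factE (K : comNzRingType) (n : nat) (a : nat -> K) (i p : nat) :
  (0 < p)%N -> rfrac_fact n a (p + i) i.+1 = (rfrac_gen n a)`_p.
Proof.
case: p => // p _; rewrite coef_rfrac_gen /rfrac_fact.
by rewrite addSn subSS addnK.
Qed.

Lemma coef_expr_lt (K : comNzRingType) (p : {poly K}) (r m : nat) :
  p`_0 = 0 -> (m < r)%N -> (p ^+ r)`_m = 0.
Proof.
move=> p0; elim: r m => // r IHr m lt_mr.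
rewrite exprS coefM big1 // => -[[|i] /= lt_i] _; first by rewrite p0 mul0r.
have m_gt0 : (0 < m)%N by rewrite -ltnS (leq_trans _ lt_i).
by rewrite IHr ?mulr0 // (@leq_trans m) // ltn_subrL.
Qed.

(** Powers above m do not contribute to the coefficient of X^m, because B has no
    constant term; hence one bound M serves for all the P_m with m <= M.  The
    power 0 accounts for the empty table. *)
Lemma rfracP_coef (K : comNzRingType) (n : nat) (a : nat -> K) (m M : nat) :
  (m <= M)%N -> rfracP n a m = (\sum_(r < M.+1) rfrac_gen n a ^+ r)`_m.
Proof.
move=> le_mM; set B := rfrac_gen n a.
have B0 : B`_0 = 0 by rewrite coef_rfrac_gen.
rewrite coef_sum big_ord_recl expr0 coef1.
rewrite /rfracP /pper_fact; case: eqP => [->|/eqP m_neq0] /=.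
  by rewrite big1 ?addr0 // => r _; rewrite coef_expr_lt.
have -> : \sum_(r < M) (B ^+ lift ord0 r)`_m = \sum_(1 <= r < M.+1) (B ^+ r)`_m.
  by rewrite big_add1 big_mkord.
rewrite add0r.
rewrite [RHS](big_cat_nat (n := m.+1)) ?ltnS //=.
rewrite [X in _ = _ + X]big_nat_cond [X in _ = _ + X]big1 ?addr0; last first.
  by move=> r /andP[/andP[lt_mr _] _]; rewrite coef_expr_lt.
apply: eq_bigr => r _; rewrite coef_exp_sum.
(* The choices with a vanishing exponent, which are not compositions, *)
(* contribute 0 to the coefficient. *)
rewrite [LHS]big_mkcond [RHS]big_mkcond; apply: eq_bigr => f _ /=.
have [sum_f|_] := eqP; last by rewrite andbF.
rewrite andbT; case: forallP => [f_gt0|f_eq0].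
  apply: eq_bigr => s _.
  rewrite (bigD1 s) //= (eq_bigl (fun t : 'I_r => (t < s)%N)); last first.
    by move=> t; rewrite ltn_neqAle andbC.
  by rewrite rfrac_factE.
have [s fs0] : exists s, f s = 0%N :> nat.
  apply: contrapT => f_neq0; apply: f_eq0 => s; rewrite lt0n; apply/eqP => fs0.
  by apply: f_neq0; exists s.
by rewrite (bigD1 s) //= fs0 B0 mul0r.
Qed.

(** Read off the coefficient of X^m in S = 1 + B S - B^(m+1), where S is the sum
    of the powers of B up to m. *)
Lemma rfracP_rec (K : comNzRingType) (n : nat) (a : nat -> K) (m : nat) :
  (0 < m)%N ->
  rfracP n a m = \sum_(1 <= k < n.+1 | (k <= m)%N) a k * rfracP n a (m - k).
Proof.
move=> m_gt0; set B := rfrac_gen n a; set S := \sum_(r < m.+1) B ^+ r.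
have B0 : B`_0 = 0 by rewrite coef_rfrac_gen.
have SE : S = 1 + B * S - B ^+ m.+1.
  rewrite {2}/S big_distrr /= big_ord_recr /= -exprS addrA addrK /S big_ord_recl.
  by rewrite expr0; congr (_ + _); apply: eq_bigr => r _; rewrite -exprS.
rewrite (@rfracP_coef _ _ _ m m) // -/S SE coefB coefD coef1 coef_expr_lt // subr0.
rewrite gtn_eqF // add0r coefM.
rewrite -(big_mkord xpredT (fun k => B`_k * S`_(m - k))) big_ltn // B0 mul0r add0r.
rewrite (big_nat_widen _ _ (n + m).+1) ?ltnS ?leq_addl //.
rewrite [RHS](big_nat_widen _ _ (n + m).+1) ?ltnS ?leq_addr //.
rewrite [LHS]big_nat_cond [RHS]big_nat_cond [LHS]big_mkcond [RHS]big_mkcond.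
apply: eq_bigr => k _; rewrite coef_rfrac_gen !ltnS.
case: k => //= k; case: (ltnP k m) => [lt_km|]; last by rewrite !andbF.
rewrite (@rfracP_coef _ _ _ _ m) ?leq_subr //.
by case: (ltnP k n); rewrite ?andbT ?andbF ?mul0r ?if_same.
Qed.

(** Deleting the first row and column leaves the same table, since its factorial
    products depend only on i - j. *)
Lemma rfracQE (K : comNzRingType) (n : nat) (a : nat -> K) (m : nat) :
  rfracQ n a m = rfracP n a m.-1.
Proof. by []. Qed.

(** * The characteristic polynomial acting on the delayed sequence *)

(** The value at m of p(E) w, where E is the shift operator on sequences. *)
Definition poly_shift (K : comNzRingType) (w : nat -> K) (m : nat) (p : {poly K}) : K :=
  \sum_(k < size p) p`_k * w (m + k)%N.

Lemma poly_shift_widen (K : comNzRingType) (w : nat -> K) (m N : nat) (p : {poly K}) :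
  (size p <= N)%N -> poly_shift w m p = \sum_(k < N) p`_k * w (m + k)%N.
Proof.
move=> le_pN; rewrite /poly_shift.
rewrite -!(big_mkord xpredT (fun k => p`_k * w (m + k)%N)).
rewrite [RHS](big_cat_nat (n := size p)) //= [X in _ = _ + X]big_nat_cond.
rewrite [X in _ = _ + X]big1 ?addr0 // => k /andP[/andP[le_pk _] _].
by rewrite nth_default ?mul0r.
Qed.

Lemma poly_shift_XsubC_mul (K : comNzRingType) (w : nat -> K) (m : nat) (z : K)
    (q : {poly K}) :
  poly_shift w m (('X - z%:P) * q) = poly_shift w m.+1 q - z * poly_shift w m q.
Proof.
have size_le : (size (('X - z%:P) * q)%R <= (size q).+1)%N.
  by rewrite (leq_trans (size_polyMleq _ _)) // size_XsubC addSn.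
rewrite (poly_shift_widen _ _ size_le) [X in _ = _ - _ * X](poly_shift_widen _ _ (leqnSn _)).
rewrite mulr_sumr; under eq_bigr => k _ do
  rewrite mulrBl coefB coefCM coefXM mulrBl -mulrA.
rewrite sumrB; congr (_ - _).
rewrite big_ord_recl mul0r add0r; apply: eq_bigr => k _ /=.
by rewrite /bump /= add1n addnS addSn.
Qed.

(** The delay by n - 1 replaces the convention P_m = 0 for m < 0, so that the
    recurrence holds from the first index with no truncation. *)
Definition rfrac_seq (K : comNzRingType) (n : nat) (a : nat -> K) (j : nat) : K :=
  if (j < n.-1)%N then 0 else rfracP n a (j - n.-1).

Lemma rfrac_seq_rec (K : comNzRingType) (n : nat) (a : nat -> K) (j : nat) :
  (0 < n)%N ->
  rfrac_seq n a (j + n) = \sum_(1 <= k < n.+1) a k * rfrac_seq n a (j + n - k).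
Proof.
case: n => // n _; rewrite /rfrac_seq /= ltnNge (leq_trans (leqnSn n)) ?leq_addl //=.
rewrite addnS -addSn addnK rfracP_rec // big_mkcond.
rewrite big_nat [RHS]big_nat; apply: eq_bigr => k /andP[_ lt_kn].
(* The terms dropped from the recurrence of P are those that fall among the *)
(* initial zeros. *)
have -> : (j.+1 + n - k < n)%N = ~~ (k <= j.+1)%N.
  have [le_kj|lt_jk] := leqP k j.+1; first by rewrite addnC -addnBA // ltnNge leq_addr.
  by rewrite ltn_subLR ?ltn_add2r ?lt_jk // addSnnS (leq_trans _ (leq_addl _ _)).
case: leqP => [le_kj|_] /=; last by rewrite mulr0.
by rewrite subnAC addnK.
Qed.

Lemma size_rfrac_poly (K : comNzRingType) (n : nat) (a : nat -> K) :
  size (rfrac_poly n a) = n.+1.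
Proof.
rewrite /rfrac_poly size_polyDl size_polyXn // size_polyN ltnS big_nat.
apply: leq_trans (size_sum _ _ _) _; apply/bigmax_leqP_seq => k _ /andP[k_gt0 le_kn].
rewrite mul_polyC (leq_trans (size_scale_leq _ _)) // size_polyXn.
by rewrite ltn_subrL k_gt0 (leq_trans k_gt0).
Qed.

Lemma poly_shift_rfrac_poly (K : comNzRingType) (n : nat) (a : nat -> K) (m : nat) :
  (0 < n)%N -> poly_shift (rfrac_seq n a) m (rfrac_poly n a) = 0.
Proof.
move=> n_gt0.
rewrite /poly_shift size_rfrac_poly /rfrac_poly.
under eq_bigr => k _ do rewrite coefB coefXn coef_sum mulrBl mulr_suml.
rewrite sumrB; apply/eqP; rewrite subr_eq0; apply/eqP.
rewrite big_ord_recr /= eqxx mul1r big1 ?add0r => [|k _]; last first.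
  by rewrite (ltn_eqF (ltn_ord k)) mul0r.
rewrite rfrac_seq_rec // exchange_big /=; apply: eq_big_nat => i /andP[_ lt_in].
have lt_sub : (n - i < n.+1)%N by rewrite ltnS leq_subr.
rewrite (bigD1 (Ordinal lt_sub)) //= big1 ?addr0 => [|k neq_k].
  by rewrite coefCM coefXn eqxx mulr1 addnBA.
rewrite coefCM coefXn (_ : (k == (n - i)%N :> nat) = false) ?mulr0 ?mul0r //.
by apply: contraNF neq_k => /eqP eq_k; apply/eqP/val_inj.
Qed.

(** All the values of the sequence before index n - 1 vanish, so only the leading
    term of a polynomial of degree n - 1 is seen at 0. *)
Lemma poly_shift_monic (K : comNzRingType) (n : nat) (a : nat -> K) (q : {poly K}) :
  q \is monic -> size q = n -> poly_shift (rfrac_seq n a) 0 q = 1.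
Proof.
move=> q_monic size_q; rewrite /poly_shift size_q.
case: n size_q => [/eqP|n size_q]; first by rewrite size_poly_eq0 (negPf (monic_neq0 q_monic)).
rewrite big_ord_recr big1 ?add0r /= => [|k _]; last first.
  by rewrite /rfrac_seq add0n ltn_ord mulr0.
move/monicP: q_monic; rewrite lead_coefE size_q /= => ->.
by rewrite mul1r /rfrac_seq ltnn subnn /rfracP /pper_fact eqxx /= add0r.
Qed.

(** This sequence in m is geometric because 'X - x maps it to 0, and its initial
    value is given by [poly_shift_monic]. *)
Lemma poly_shift_cofactor (K : comNzRingType) (n : nat) (a : nat -> K) (x : K)
    (q : {poly K}) (m : nat) :
  (0 < n)%N -> rfrac_poly n a = ('X - x%:P) * q -> q \is monic -> size q = n ->
  poly_shift (rfrac_seq n a) m q = x ^+ m.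
Proof.
move=> n_gt0 pE q_monic size_q; elim: m => [|m IHm].
  by rewrite (poly_shift_monic a).
have := poly_shift_rfrac_poly a m n_gt0.
by rewrite pE poly_shift_XsubC_mul IHm -exprS => /subr0_eq.
Qed.

Lemma horner_rfrac_poly0 (K : comNzRingType) (n : nat) (a : nat -> K) :
  (0 < n)%N -> (rfrac_poly n a).[0] = - a n.
Proof.
case: n => // n _; rewrite /rfrac_poly !hornerE expr0n sub0r horner_sum big_nat_recr //=.
rewrite subnn hornerM hornerXn hornerC expr0 mulr1 big_nat big1 ?add0r // => k /andP[_ lt_kn].
by rewrite !hornerE expr0n subn_eq0 leqNgt lt_kn mulr0.
Qed.

Lemma rmorph_rfracP (K L : comNzRingType) (f : {rmorphism K -> L}) (n : nat)
    (a : nat -> K) (m : nat) :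
  rfracP n (f \o a) m = f (rfracP n a m).
Proof.
rewrite /rfracP /pper_fact; case: ifP => _; first by rewrite rmorph1.
rewrite rmorph_sum; apply: eq_bigr => r _; rewrite rmorph_sum; apply: eq_bigr => p _.
rewrite rmorph_prod; apply: eq_bigr => s _.
by rewrite /rfrac_fact; case: ifP; rewrite ?rmorph0.
Qed.

Lemma rmorph_rfrac_seq (K L : comNzRingType) (f : {rmorphism K -> L}) (n : nat)
    (a : nat -> K) (m : nat) :
  rfrac_seq n (f \o a) m = f (rfrac_seq n a m).
Proof. by rewrite /rfrac_seq rmorph_rfracP; case: ifP; rewrite ?rmorph0. Qed.

(** * Convergence and first-order recurrences *)

(** The distance d_m from g_m to the expected limit satisfies
    d_(m+1) <= |rho| d_m + o(1).  Once the error term is below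
    e (1 - |rho|) / 2, the quantity d_m - e / 2 contracts by the factor |rho| at
    each step, hence is eventually less than e / 2.

    The convergence of the powers is a hypothesis because it may fail in a field
    that is not archimedean. *)
Lemma cvg_affine_rec (K : numFieldType) (g : nat -> K) (rho l : K) :
  `|rho| < 1 -> `|rho| ^+ m @[m --> \oo] --> (0 : K) ->
  g m.+1 - rho * g m @[m --> \oo] --> l ->
  g m @[m --> \oo] --> l / (1 - rho).
Proof.
move=> rho_lt1 rho_cvg0 dg_cvg.
have rho_neq1 : 1 - rho != 0.
  by rewrite subr_eq0 eq_sym; apply: contraTN rho_lt1 => /eqP ->; rewrite normr1 ltxx.
have gap_gt0 : 0 < 1 - `|rho| by rewrite subr_gt0.
set c := l / (1 - rho).
apply/cvgrPdist_lt => e e_gt0.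
have d_gt0 : 0 < e / 2 * (1 - `|rho|) by rewrite mulr_gt0 ?divr_gt0.
have [N _ near_l] := (cvgrPdist_lt _ _).1 dg_cvg _ d_gt0.
have step m : (N <= m)%N ->
    `|c - g m.+1| - e / 2 <= `|rho| * (`|c - g m| - e / 2).
  move=> le_Nm.
  have -> : c - g m.+1 = rho * (c - g m) + (l - (g m.+1 - rho * g m)).
    have -> : l = c * (1 - rho) by rewrite divfK.
    by rewrite !mulrBr mulr1 (mulrC c) opprB !addrA -!addrA; ring.
  rewrite lerBlDr (le_trans (ler_normD _ _)) // normrM.
  rewrite [leRHS](_ : _ = `|rho| * `|c - g m| + e / 2 * (1 - `|rho|)); last by ring.
  by rewrite lerD2l ltW // near_l.
have bound k : `|c - g (N + k)%N| - e / 2 <= `|rho| ^+ k * (`|c - g N| - e / 2).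
  elim: k => [|k IHk]; first by rewrite addn0 expr0 mul1r.
  rewrite addnS (le_trans (step _ (leq_addr _ _))) // exprS -mulrA.
  by rewrite ler_wpM2l.
have : `|rho| ^+ k * (`|c - g N| - e / 2) @[k --> \oo] --> (0 : K).
  by rewrite -[X in _ --> X](mul0r (`|c - g N| - e / 2)); apply: cvgMr_tmp.
have e2_gt0 : 0 < e / 2 by rewrite divr_gt0.
move=> /cvgrPdist_lt /(_ _ e2_gt0) [M _ small].
exists (N + M)%N => // m /= le_m.
have le_Nm : (N <= m)%N by rewrite (leq_trans _ le_m) ?leq_addr.
have le_Mm : (M <= m - N)%N by rewrite leq_subRL.
have := bound (m - N)%N; rewrite subnKC // => bound_m.
rewrite -(ltrD2r (- (e / 2))) (le_lt_trans bound_m) //.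
have -> : e - e / 2 = e / 2 by rewrite {1}(splitr e) addrK.
have := small _ le_Mm; rewrite /= sub0r normrN; apply: le_lt_trans.
rewrite real_ler_norm // realM ?realB ?realX ?normr_real // gtr0_real //.
Qed.

(** Type inference finds the topology of a field from its structure of
    [numFieldType], which the bare carrier [R[i]] does not display. *)
Definition complex_numField (R : rcfType) : numFieldType := R[i].

Lemma cvg_geometric_complex (R : realType) (z : R[i]) :
  `|z| < 1 -> `|z| ^+ m @[m --> \oo] --> (0 : complex_numField R).
Proof.
move=> z_lt1; have [r r_ge0 zE] : exists2 r : R, 0 <= r & `|z| = r%:C.
  by rewrite normc_def; eexists; last by []; rewrite sqrtr_ge0.
have r_lt1 : `|r| < 1 by rewrite ger0_norm // -ltcR -zE.
apply/(@cvgrPdist_lt (complex_numField R) (complex_numField R)) => e e_gt0.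
have eE : e = (complex.Re e)%:C by rewrite RRe_real // gtr0_real.
have Re_gt0 : 0 < complex.Re e by rewrite -ltcR -eE.
have [N _ small] := (cvgrPdist_lt _ _).1 (cvg_expr r_lt1) _ Re_gt0.
exists N => // m le_Nm; have := small _ le_Nm; rewrite /= !sub0r !normrN.
by rewrite zE -rmorphXn normc_def /= expr0n addr0 sqrtr_sqr eE ltcR.
Qed.

(** If Im c were nonzero, every real number would be at distance at least |Im c|
    from c. *)
Lemma cvg_real_complex (R : realType) (f : nat -> R) (c : R[i]) :
  (f m)%:C @[m --> \oo] --> (c : complex_numField R) ->
  exists2 r : R, c = r%:C & f m @[m --> \oo] --> r.
Proof.
move=> /(@cvgrPdist_lt (complex_numField R) (complex_numField R)) f_cvg.
have ler_sqrtD (x y : R) : Num.sqrt (x ^+ 2) <= Num.sqrt (x ^+ 2 + y ^+ 2).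
  by rewrite ler_sqrt ?addr_ge0 ?sqr_ge0 // lerDl sqr_ge0.
exists (complex.Re c); last first.
  apply/cvgrPdist_lt => e e_gt0.
  have eC_gt0 : 0 < e%:C by rewrite -[0]/(0%:C) ltcR.
  have [N _ close] := f_cvg _ eC_gt0.
  exists N => // m le_Nm; rewrite -ltcR (le_lt_trans _ (close _ le_Nm)) //.
  by apply: le_trans (normc_ge_Re _); rewrite lecR raddfB.
case: c f_cvg => x y f_cvg /=; have [->//|y_neq0] := eqVneq y 0.
have y_gt0 : 0 < `|y|%:C by rewrite -[0]/(0%:C) ltcR normr_gt0.
have [N _ /(_ N (leqnn N))] := f_cvg _ y_gt0.
rewrite /= normc_def ltcR /= subr0 addrC -sqrtr_sqr => /(le_lt_trans (ler_sqrtD _ _)).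
by rewrite ltxx.
Qed.

(** Each factor X - z acts on w_m / x1^m as the map
    g |-> x1 (g_(m+1) - (z / x1) g_m), which [cvg_affine_rec] inverts at the level
    of limits: it turns a limit l into l / x1 / (1 - z / x1), still nonzero. *)
Lemma cvg_cancel_factors (K : numFieldType) (w : nat -> K) (x1 : K) (s : seq K) (l : K) :
  (forall z : K, `|z| < 1 -> `|z| ^+ m @[m --> \oo] --> (0 : K)) ->
  x1 != 0 -> (forall z, z \in s -> `|z| < `|x1|) -> l != 0 ->
  poly_shift w m (\prod_(z <- s) ('X - z%:P)) / x1 ^+ m @[m --> \oo] --> l ->
  exists2 c : K, c != 0 & w m / x1 ^+ m @[m --> \oo] --> c.
Proof.
move=> geom x1_neq0; elim: s l => [|z s IHs] l lt_x1 l_neq0.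
  have -> : (fun m => poly_shift w m (\prod_(z <- [::]) ('X - z%:P)) / x1 ^+ m)
      = (fun m => w m / x1 ^+ m).
    by apply/funext => m; rewrite big_nil /poly_shift size_poly1 big_ord1 coef1 mul1r addn0.
  by exists l.
set q := \prod_(z <- s) ('X - z%:P); set g := fun m => poly_shift w m q / x1 ^+ m.
have -> : (fun m => poly_shift w m (\prod_(z <- z :: s) ('X - z%:P)) / x1 ^+ m)
    = (fun m => x1 * (g m.+1 - z / x1 * g m)).
  apply/funext => m; rewrite big_cons poly_shift_XsubC_mul /g -/q exprS.
  have xm_neq0 : x1 ^+ m != 0 by rewrite expf_neq0.
  by field; rewrite xm_neq0 x1_neq0.
move=> /(@cvgMl_tmp _ _ _ _ _ x1^-1).
under eq_fun do rewrite mulKf //.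
have rho_lt1 : `|z / x1| < 1.
  by rewrite normf_div ltr_pdivrMr ?normr_gt0 // mul1r lt_x1 // mem_head.
move=> /(cvg_affine_rec rho_lt1 (geom _ rho_lt1)); apply: IHs.
  by move=> y y_s; rewrite lt_x1 // in_cons y_s orbT.
rewrite mulf_neq0 ?mulf_neq0 ?invr_eq0 // subr_eq0.
by apply: contraTneq rho_lt1 => <-; rewrite normr1 ltxx.
Qed.

(** * Convergence of the rational truncations *)

Theorem mainTheorem2 (R : realType) (n : nat) (a : nat -> int)
    (n_ge1 : (1 <= n)%N) (an_neq0 : a n != 0)
    (rs : seq R[i])
    (rs_roots : rfrac_poly n (fun k => (a k)%:~R : R[i])
                = \prod_(z <- rs) ('X - z%:P))
    (rs_distinct : uniq rs)
    (x1 : R) (x1_root : x1%:C \in rs)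
    (x1_dominant : forall z : R[i], z \in rs -> z != x1%:C -> `|z| < `|x1%:C|) :
  (\forall m \near \oo, rfracQ n a m != 0) /\
  ((rfracP n a m)%:~R / (rfracQ n a m)%:~R : R) @[m --> \oo] --> x1.
Proof.
set aC := fun k => (a k)%:~R : R[i] in rs_roots.
(* A vanishing root would make the constant coefficient - a n vanish. *)
have x1C_neq0 : x1%:C != 0.
  apply: contraTneq x1_root => ->.
  rewrite -root_prod_XsubC -rs_roots rootE horner_rfrac_poly0 // oppr_eq0.
  by rewrite intr_eq0.
have x1_neq0 : x1 != 0 by apply: contraNneq x1C_neq0 => ->.
set q := \prod_(z <- rem x1%:C rs) ('X - z%:P).
have polyE : rfrac_poly n aC = ('X - (x1%:C)%:P) * q by rewrite rs_roots (big_rem x1%:C).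
have size_q : size q = n.
  have := size_rfrac_poly n aC; rewrite rs_roots size_prod_XsubC => -[<-].
  by rewrite size_prod_XsubC size_rem // prednK // -has_predT; apply/hasP; exists x1%:C.
have [| |c c_neq0] := @cvg_cancel_factors (complex_numField R) (rfrac_seq n aC) x1%:C
    (rem x1%:C rs) 1 (@cvg_geometric_complex R) x1C_neq0 _ (oner_neq0 _).
  (* Here the roots must be simple: x1 may not occur again among the others. *)
  by move=> z; rewrite mem_rem_uniq // => /andP[z_neq z_rs]; exact: x1_dominant.
  under eq_fun => m do
    rewrite (poly_shift_cofactor m n_ge1 polyE) ?monic_prod_XsubC // divff ?expf_neq0 //.
  exact: cvg_cst.
set F := fun m => (rfrac_seq n a m)%:~R / x1 ^+ m : R.
have -> : (fun m => rfrac_seq n aC m / x1%:C ^+ m) = (fun m => (F m)%:C).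
  apply/funext => m; rewrite /F fmorph_div rmorphXn rmorph_int.
  by rewrite -(rmorph_rfrac_seq intr).
move=> /cvg_real_complex[r cE F_cvg].
have r_neq0 : r != 0 by apply: contraNneq c_neq0 => r0; rewrite cE r0.
have FQ_cvg : F (m + n.-1)%N @[m --> \oo] --> r by rewrite (cvg_shiftn n.-1 F).
have FP_cvg : F (m.+1 + n.-1)%N @[m --> \oo] --> r.
  by rewrite (cvg_shiftS (fun m => F (m + n.-1)%N)).
have seqE m : rfrac_seq n a (m + n.-1) = rfracP n a m.
  by rewrite /rfrac_seq ltnNge leq_addl addnK.
have Q_neq0 : \forall m \near \oo, rfracP n a m != 0.
  have [N _ F_neq0] := cvgr_neq0 _ FQ_cvg r_neq0; exists N => // m /F_neq0 /=.
  by apply: contraNneq; rewrite /F seqE => ->; rewrite mul0r.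
split; first by apply: near_inftyS; exact: Q_neq0.
rewrite -(cvg_shiftS (fun m => (rfracP n a m)%:~R / (rfracQ n a m)%:~R : R)) /=.
have ratio_cvg : x1 * (F (m.+1 + n.-1)%N / F (m + n.-1)%N) @[m --> \oo] --> x1.
  rewrite -[X in _ --> X]mulr1 -(divff r_neq0).
  by apply: cvgMl_tmp; apply: cvgM => //; apply: cvgV.
apply: cvg_trans ratio_cvg; apply: near_eq_cvg.
have [N _ P_neq0] := Q_neq0; exists N => // m /P_neq0 /= Pm_neq0.
rewrite rfracQE /F !seqE addSn exprS.
have xm_neq0 : x1 ^+ (m + n.-1) != 0 by rewrite expf_neq0.
have PmR_neq0 : (rfracP n a m)%:~R != 0 :> R by rewrite intr_eq0.
by field; rewrite x1_neq0 xm_neq0 PmR_neq0.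
Qed.
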